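(* Let $n$ be a positive integer and $j$ an integer with $0\le j\le n$. Then \[ T(n,j)=\frac{1}{2n+1}\binom{2n+j}{j}\binom{2n+1}{n+j+1} \] equals the number of lattice paths in the plane from $(0,0)$ to $(n,2n)$, using steps $(1,0)$, $(0,1)$ and $(1,1)$, that never go below the line $y=2x$ (i.e. every lattice point $(x,y)$ on the path satisfies $y\ge 2x$) and that use exactly $j$ steps of the form $(1,0)$. *)

(* Defs.v *)
From mathcomp Require Import all_boot all_order all_algebra.
From mathcomp Require Import finmap.
From mathcomp Require Import classical_sets cardinality.

Set Implicit Arguments.
Unset Strict Implicit.
Unset Printing Implicit Defensive.

Import Order.TTheory GRing.Theory Num.Theory.
Local Open Scope ring_scope.

(* A path from the origin is encoded by its sequence of steps. *)
Definition point : Type := int * int.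

Definition step_east : point := (1, 0).
Definition step_north : point := (0, 1).
Definition step_diag : point := (1, 1).

Definition allowed_steps : seq point :=
  [:: step_east; step_north; step_diag].

Definition visited (s : seq point) : seq point := 0 :: scanl +%R 0 s.

Definition endpoint (s : seq point) : point := last 0 (visited s).

Definition not_below (p : point) : bool := 2 * p.1 <= p.2.

Definition lattice_paths (n j : nat) : set (seq point) :=
  [set s | [/\ all (mem allowed_steps) s,
               endpoint s = (n%:Z, (2 * n)%N%:Z),
               all not_below (visited s)
             & count_mem step_east s = j]]%classic.

Definition T (n j : nat) : rat :=
  (2 * n + 1)%N%:R^-1 * 'C((2 * n + j)%N, j)%:R * 'C((2 * n + 1)%N, (n + j + 1)%N)%:R.

(* Main.v *)
(* The height y - 2x drops by 2, drops by 1 or grows by 1 along an east, diagonal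
   or north step.  With e, d and m steps of these kinds, the number of paths whose
   height stays nonnegative is
     (h + 1) (e + d + m)! / (e! d! (m + 1)!),   where h = m - 2e - d
   is the final height.  Removing the last step gives a recurrence for this number,
   which the closed form satisfies because
     e (h + 3) + d (h + 2) + (m + 1) h = (h + 1) (e + d + m);
   the closed form also vanishes at h = -1, the only negative height that the
   recurrence reaches.  The theorem is the case h = 0 with
   (e, d, m) = (j, n - j, n + j). *)
Require Import Defs.
From mathcomp Require Import all_boot all_order all_algebra.
From mathcomp Require Import finmap.
From mathcomp Require Import classical_sets cardinality.
From mathcomp Require Import zify ring.

Import Order.TTheory GRing.Theory Num.Theory.
Local Open Scope ring_scope.

Lemma visited_rcons s x : visited (rcons s x) = rcons (visited s) (endpoint s + x).
Proof.
rewrite /endpoint /visited /=; elim: s 0 => [|y s IHs] z //=.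
by rewrite (IHs (z + y)).
Qed.

Lemma endpoint_rcons s x : endpoint (rcons s x) = endpoint s + x.
Proof. by rewrite /endpoint visited_rcons last_rcons. Qed.

Lemma endpoint_count s : all (mem allowed_steps) s ->
  endpoint s = ((count_mem step_east s + count_mem step_diag s)%N%:Z,
                (count_mem step_diag s + count_mem step_north s)%N%:Z).
Proof.
elim/last_ind: s => [//|s x IHs]; rewrite all_rcons => /andP[x_step /IHs ends].
rewrite endpoint_rcons ends -!cats1 !count_cat /=.
by move: x_step; rewrite !inE => /or3P[] /eqP-> /=; congr (_, _) => /=; lia.
Qed.

Lemma size_count s : all (mem allowed_steps) s ->
  size s = (count_mem step_east s + count_mem step_diag s
            + count_mem step_north s)%N.
Proof.
elim: s => [//|x s IHs] /= /andP[+ /IHs->].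
by rewrite !inE => /or3P[] /eqP-> /=; lia.
Qed.

Definition admissible (s : seq Defs.point) : bool :=
  all (mem allowed_steps) s && all not_below (visited s).

Lemma admissible_rcons s x : admissible (rcons s x) =
  [&& x \in allowed_steps, admissible s & not_below (endpoint (rcons s x))].
Proof.
rewrite /admissible visited_rcons endpoint_rcons !all_rcons -!andbA.
by congr (_ && _); rewrite andbCA andbC -andbA.
Qed.

Definition extend (x : Defs.point) (l : seq (seq Defs.point)) := map (rcons^~ x) l.

Lemma mem_extend x y s l : (rcons s y \in extend x l) = (y == x) && (s \in l).
Proof.
apply/mapP/andP => [[t tl /rcons_inj[-> ->]]|[/eqP-> sl]]; last by exists s.
by rewrite eqxx.
Qed.

Lemma nil_notin_extend x l : ([::] \in extend x l) = false.
Proof. by apply/mapP => -[[|y t]]. Qed.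

Lemma extend_uniq x l : uniq (extend x l) = uniq l.
Proof. by apply: map_inj_uniq => s t /rcons_inj[]. Qed.

(* [k] is only the recursion argument: the list is empty unless [k = e + d + m]. *)
Fixpoint paths (k e d m : nat) : seq (seq Defs.point) :=
  if k is k'.+1 then
    if (2 * e + d <= m)%N then
      extend step_east (if e is e'.+1 then paths k' e' d m else [::]) ++
      extend step_diag (if d is d'.+1 then paths k' e d' m else [::]) ++
      extend step_north (if m is m'.+1 then paths k' e d m' else [::])
    else [::]
  else if (e + d + m == 0)%N then [:: [::]] else [::].

(** By induction on the length, removing the last step. The earlier points are handled by the
    recursive call, and at the final point [(e + d, d + m)] the condition [not_below] is
    [2 * e + d <= m]. *)
Lemma mem_paths k e d m (s : seq Defs.point) : (s \in paths k e d m) =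
  [&& size s == k, admissible s, count_mem step_east s == e,
      count_mem step_diag s == d & count_mem step_north s == m].
Proof.
elim: k e d m s => [|k IHk] e d m s /=.
  by case: s => [|x s]; case: e d m => [|e] [|d] [|m].
case/lastP: s => [|s x]; first by case: ifP; rewrite ?mem_cat ?nil_notin_extend.
rewrite size_rcons eqSS admissible_rcons -!cats1 !count_cat /= !addn0 cats1.
have [x_step|x_nstep] := boolP (x \in allowed_steps); last first.
  rewrite andbF; case: ifP => // _; rewrite !mem_cat !mem_extend.
  by move: x_nstep; rewrite !inE !negb_or => /and3P[/negPf-> /negPf-> /negPf->].
have [adm|nadm] := boolP (admissible s); last first.
  rewrite andbF; case: ifP => // _; rewrite !mem_cat !mem_extend.
  by case: e d m => [|e] [|d] [|m]; rewrite ?IHk ?(negPf nadm) ?andbF.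
have s_steps : all (mem allowed_steps) s by case/andP: adm.
rewrite /= /not_below endpoint_rcons (endpoint_count _ s_steps).
move: x_step; rewrite !inE => /or3P[] /eqP-> /=.
- case: ifP => above; rewrite ?mem_cat ?mem_extend /=;
    first case: e above => [|e] above; rewrite ?IHk ?adm ?in_nil /=; lia.
- case: ifP => above; rewrite ?mem_cat ?mem_extend /=;
    first case: m above => [|m] above; rewrite ?IHk ?adm ?in_nil /=; lia.
- case: ifP => above; rewrite ?mem_cat ?mem_extend /=;
    first case: d above => [|d] above; rewrite ?IHk ?adm ?in_nil /=; lia.
Qed.

(** The three blocks are disjoint because their members end in different steps. *)
Lemma paths_uniq k e d m : uniq (paths k e d m).
Proof.
elim: k e d m => [|k IHk] e d m /=; first by case: ifP.
case: ifP => // _.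
rewrite !cat_uniq !extend_uniq has_cat !negb_or.
have disj x y l l' : x != y -> ~~ has (mem (extend x l)) (extend y l').
  move=> xy; apply/hasPn => s /mapP[t _ ->] /=.
  by rewrite mem_extend eq_sym (negPf xy).
by rewrite !disj // !andbT; case: e d m => [|e] [|d] [|m]; rewrite ?IHk.
Qed.

(** The closed form with denominators cleared. The truncated difference is [h + 1] for a final
    height [h >= -1], and 0 below that, where the list is empty too. *)
Lemma size_paths k e d m : (e + d + m = k)%N ->
  (size (paths k e d m) * (e`! * d`! * m.+1`!) =
   (m.+1 - (2 * e + d)) * k`!)%N.
Proof.
elim: k e d m => [|k IHk] e d m edm.
  by case: e d m edm => [|[]] [|[]] [|[]].
rewrite [paths _ _ _ _]/=; case: leqP => [h_ge0|h_lt0]; last first.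
  by have /eqP-> : (m.+1 - (2 * e + d) == 0)%N by rewrite subn_eq0.
have [h def_m] : exists h, m = (h + (2 * e + d))%N.
  by exists (m - (2 * e + d))%N; rewrite subnK.
rewrite !size_cat !size_map !mulnDl.
set a := (size _ * _)%N; set b := (size _ * _)%N; set c := (size _ * _)%N.
(* Before an east step the height was [h + 2], so the induction hypothesis gives the factor [h + 3];
   the factor [e] comes from [e!]. *)
have -> : a = (e * (h + 3) * k`!)%N.
  rewrite /a {a b c}; case: e => [|e] in edm def_m h_ge0 *.
    by rewrite !mul0n.
  have /IHk IH : (e + d + m = k)%N by lia.
  rewrite factS (_ : h + 3 = m.+1 - (2 * e + d))%N; last by lia.
  by rewrite -!mulnA -IH; ring.
have -> : b = (d * (h + 2) * k`!)%N.
  rewrite /b {a b c}; case: d => [|d] in edm def_m h_ge0 *.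
    by rewrite !mul0n.
  have /IHk IH : (e + d + m = k)%N by lia.
  rewrite factS (_ : h + 2 = m.+1 - (2 * e + d))%N; last by lia.
  by rewrite -!mulnA -IH; ring.
(* Before a north step the height was [h - 1]; for [h = 0] the factor [h] vanishes, as it should. If
   [m = 0], then [h = 0]. *)
have -> : c = (m.+1 * h * k`!)%N.
  rewrite /c {a b c}; case: m => [|m] in edm def_m h_ge0 *.
    by rewrite (_ : h = 0)%N //; lia.
  have /IHk IH : (e + d + m = k)%N by lia.
  rewrite (factS m.+1) (_ : h = m.+1 - (2 * e + d))%N; last by lia.
  by rewrite -!mulnA -IH; ring.
(* What remains is the weighted identity for the three factors, which holds once [m = h + 2 * e + d]
   is substituted. *)
rewrite factS -edm (_ : m.+1 - _ = h.+1)%N; last by lia.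
by rewrite def_m; ring.
Qed.

(** With [j] east steps, the abscissa [n] forces [n - j] diagonal steps, and then the ordinate
    [2 * n] forces [n + j] north steps. *)
Lemma lattice_pathsE n j : (j <= n)%N ->
  lattice_paths n j = [set` paths (2 * n + j) j (n - j) (n + j)]%classic.
Proof.
move=> le_jn; apply/seteqP; split=> s /=; rewrite mem_paths.
  case=> s_steps s_end s_above s_east.
  move: s_end; rewrite (endpoint_count _ s_steps) => -[s_x s_y].
  rewrite /admissible (size_count _ s_steps) s_steps s_above s_east eqxx /=.
  by move: s_x; rewrite s_east => s_x; apply/and3P; split; apply/eqP; lia.
case/and5P=> _ /andP[s_steps s_above] /eqP s_east /eqP s_diag /eqP s_north.
split=> //; rewrite (endpoint_count _ s_steps) s_east s_diag s_north.
by congr (_, _); lia.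
Qed.

(** In factorials the two binomials contribute [(2n + 1)! / (2n)!], which cancels the prefactor
    [1 / (2n + 1)]. *)
Lemma T_fact n j : (j <= n)%N ->
  T n j * (j`! * (n - j)`! * (n + j).+1`!)%N%:R = (2 * n + j)`!%:R.
Proof.
move=> le_jn.
have binN1 := @bin_fact (2 * n + j) j (leq_addl _ _).
have binN2 : ('C(2 * n + 1, n + j + 1) *
    ((n + j + 1)`! * (2 * n + 1 - (n + j + 1))`!) = (2 * n + 1)`!)%N.
  by apply: bin_fact; lia.
rewrite (_ : 2 * n + 1 - (n + j + 1) = n - j)%N in binN2; last by lia.
rewrite addnK in binN1.
have n2_neq0 : (2 * n + 1)%N%:R != 0 :> rat by rewrite pnatr_eq0 addn1.
have f_neq0 : (2 * n)`!%:R != 0 :> rat by rewrite pnatr_eq0 -lt0n fact_gt0.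
apply: (mulfI n2_neq0); apply: (mulfI f_neq0).
rewrite /T -!mulrA mulVKf // -!natrM; congr _%:R.
transitivity ((2 * n + 1)`! * (2 * n + j)`!)%N.
  by rewrite -binN1 -binN2 (addn1 (n + j)); ring.
by rewrite addn1 factS; ring.
Qed.

(* [fset_set A] is empty when [A] is infinite, hence the first conjunct. *)
Theorem theorem4 (n j : nat) (n_gt0 : (0 < n)%N) (le_jn : (j <= n)%N) :
  finite_set (lattice_paths n j) /\
  T n j = (#|` fset_set (lattice_paths n j)|%fset)%:R.
Proof.
rewrite (lattice_pathsE _ _ le_jn); split; first exact: finite_seq.
set l := paths _ _ _ _.
have -> : fset_set [set` l]%classic = [fset s in l]%fset.
  by apply/fsetP => s; rewrite in_fset_set ?inE ?mem_setE //; apply: finite_seq.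
rewrite card_imfset //= undup_id ?paths_uniq //.
have size_l : (j + (n - j) + (n + j) = 2 * n + j)%N by lia.
have := size_paths _ _ _ _ size_l.
(* The path ends on the line [y = 2x], so [h + 1 = 1]. *)
rewrite (_ : (n + j).+1 - (2 * j + (n - j)) = 1)%N; last by lia.
rewrite mul1n => /(congr1 (fun k => k%:R : rat)); rewrite -(T_fact _ _ le_jn) natrM.
by move/mulIf => -> //; rewrite pnatr_eq0 -lt0n !muln_gt0 !fact_gt0.
Qed.
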